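(* Let $M^3(\phi,\xi,\eta,g)$ be a 3-dimensional $(\kappa,\mu)$-contact metric manifold. Then $M$ is $\phi$-recurrent if and only if $M$ is flat.
   Context: A contact metric manifold $M^{2n+1}(\phi,\xi,\eta,g)$ is a smooth $(2n+1)$-dimensional manifold with a global 1-form $\eta$ satisfying $\eta\wedge(d\eta)^n\neq 0$ everywhere, a global vector field $\xi$, a $(1,1)$-tensor field $\phi$ and a Riemannian metric $g$ such that $\eta(\xi)=1$, $\phi^2=-\mathrm{Id}+\eta\otimes\xi$, $g(\phi X,\phi Y)=g(X,Y)-\eta(X)\eta(Y)$ and $d\eta(X,Y)=g(X,\phi Y)$ for all vector fields $X,Y$, with the convention $d\eta(X,Y)=\frac12\big(X\eta(Y)-Y\eta(X)-\eta([X,Y])\big)$. Let $\nabla$ be the Levi-Civita connection of $g$ and $R(X,Y)Z=\nabla_X\nabla_YZ-\nabla_Y\nabla_XZ-\nabla_{[X,Y]}Z$ its curvature tensor. Put $hX=\frac12(\mathcal{L}_\xi\phi)X$, where $\mathcal{L}$ is the Lie derivative. For real constants $(\kappa,\mu)\in\mathbb{R}^2$, a contact metric manifold is a $(\kappa,\mu)$-contact metric manifold if $R(X,Y)\xi=\kappa(\eta(Y)X-\eta(X)Y)+\mu(\eta(Y)hX-\eta(X)hY)$ for all vector fields $X,Y$. A contact metric manifold is $\phi$-recurrent if there exists a non-zero (i.e. not identically zero) 1-form $A$ on $M$ such that $\phi^2((\nabla_WR)(X,Y)Z)=A(W)R(X,Y)Z$ for all vector fields $X,Y,Z,W$ on $M$.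 Flat means $R=0$. *)

(* Defs.v *)
From HB Require Import structures.
From mathcomp Require Import all_boot all_order all_algebra all_fingroup.
From mathcomp Require Import all_classical all_reals all_analysis.
From mathcomp Require Import ring.

Set Implicit Arguments.
Unset Strict Implicit.
Unset Printing Implicit Defensive.
Import Order.TTheory GRing.Theory Num.Theory.
Import numFieldNormedType.Exports.
Local Open Scope classical_set_scope.
Local Open Scope ring_scope.

Section SmoothEuclidean.
Context {R : realType} {d : nat}.
Local Notation V := 'rV[R]_d.
Implicit Types (U : set V) (f g : V -> R) (i j : 'I_d).

Definition partial i f : V -> R := fun x => 'D_(delta_mx 0 i) f x.

(* Only used for open U, where it says that f is k times continuously
   differentiable on U. *)
Fixpoint Ck (k : nat) U f : Prop :=
  if k is k'.+1 then
    (forall x, U x -> differentiable f x) /\ (forall i, Ck k' U (partial i f))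
  else forall x, U x -> {for x, continuous f}.

Definition smooth_on U f : Prop := forall k, Ck k U f.

Lemma near_eq_differentiable f g (x : V) :
  (\near x, f x = g x) -> differentiable f x -> differentiable g x.
Proof.
move=> fg df; have -> : g = f + (g - f) by apply/funext => y; rewrite !fctE addrC subrK.
apply: differentiableD => //.
set h := g - f.
have h0 : \near x, h x = 0.
  by near=> y; rewrite /h !fctE (near fg y)// subrr.
have ho : h \o shift x = cst (h x) + (\0 : V -> R) +o_ (nbhs (0 : V)) id.
  apply/eqaddoP => e e0; near=> y.
  rewrite /= !fctE /cst /= (nbhs_singleton h0) addr0 subr0.
  suff -> : h (y + x) = 0 by rewrite normr0 mulr_ge0// ltW.
  near: y.
  by have := h0; rewrite (near_shift 0) subr0.
have c0 : continuous (\0 : V -> R) by move=> y; exact: cst_continuous.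
have dh := @diff_unique R V R h (\0 : {linear V -> R}) x c0 ho.
by apply/diff_locallyP; rewrite dh.
Unshelve. all: by end_near. Qed.

Lemma open_near U x (P : V -> Prop) : open U -> U x -> (forall y, U y -> P y) ->
  \forall y \near x, P y.
Proof. by move=> oU Ux UP; apply: filterS UP _; exact: open_nbhs_nbhs. Qed.

Lemma partial_ext U f g i : open U -> (forall x, U x -> f x = g x) ->
  forall x, U x -> partial i f x = partial i g x.
Proof. by move=> oU fg x Ux; apply: near_eq_derive; exact: open_near oU Ux fg. Qed.

Lemma Ck_ext k U f g : open U -> (forall x, U x -> f x = g x) ->
  Ck k U f -> Ck k U g.
Proof.
move=> oU; elim: k f g => [|k IH] f g fg /=.
  move=> cf x Ux; have nfg := open_near oU Ux fg.
  rewrite /prop_for /continuous_at -(fg x)//.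
  exact: cvg_trans (near_eq_cvg nfg) (cf x Ux).
case=> df Cf; split=> [x Ux|i].
  exact: near_eq_differentiable (open_near oU Ux fg) (df x Ux).
by apply: IH (Cf i) => x; exact: partial_ext.
Qed.

Lemma CkW k U f : Ck k.+1 U f -> Ck k U f.
Proof.
elim: k f => [|k IH] f /= [df Cf].
  by move=> x Ux; exact/differentiable_continuous/df.
by split=> // i; exact: IH (Cf i).
Qed.

Lemma partial_cst i (c : R) x : partial i (cst c) x = 0.
Proof. exact: derive_cst. Qed.

Lemma Ck_cst k U (c : R) : open U -> Ck k U (cst c).
Proof.
move=> oU; elim: k c => [|k IH] c /=; first by move=> x _; exact: cst_continuous.
split=> [x _|i]; first exact: differentiable_cst.
by apply: Ck_ext (IH 0) => // x _; rewrite partial_cst.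
Qed.

Lemma CkD k U f g : open U -> Ck k U f -> Ck k U g -> Ck k U (f + g).
Proof.
move=> oU; elim: k f g => [|k IH] f g.
  by move=> cf cg x Ux; apply: continuousD; [exact: cf|exact: cg].
move=> [df Cf] [dg Cg]; split=> [x Ux|i].
  by apply: differentiableD; [exact: df|exact: dg].
apply: Ck_ext (IH _ _ (Cf i) (Cg i)) => // x Ux.
by rewrite /partial deriveD//; apply: diff_derivable; [exact: df|exact: dg].
Qed.

Lemma CkN k U f : open U -> Ck k U f -> Ck k U (- f).
Proof.
move=> oU; elim: k f => [|k IH] f; first by move=> cf x Ux; apply: continuousN; exact: cf.
move=> [df Cf]; split=> [x Ux|i]; first by apply: differentiableN; exact: df.
apply: Ck_ext (IH _ (Cf i)) => // x Ux.
by rewrite /partial deriveN//; apply: diff_derivable; exact: df.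
Qed.

Lemma CkM k U f g : open U -> Ck k U f -> Ck k U g -> Ck k U (f * g).
Proof.
move=> oU; elim: k f g => [|k IH] f g.
  by move=> cf cg x Ux; apply: continuousM; [exact: cf|exact: cg].
move=> /[dup] /CkW Cf0 [df Cf] /[dup] /CkW Cg0 [dg Cg]; split=> [x Ux|i].
  by apply: differentiableM; [exact: df|exact: dg].
apply: Ck_ext (CkD oU (IH _ _ Cf0 (Cg i)) (IH _ _ Cg0 (Cf i))) => // x Ux.
by rewrite /partial deriveM//; apply: diff_derivable; [exact: df|exact: dg].
Qed.

Lemma smooth_ext U f g : open U -> (forall x, U x -> f x = g x) ->
  smooth_on U f -> smooth_on U g.
Proof. by move=> oU fg sf k; exact: Ck_ext (sf k). Qed.

Lemma smooth_cst U (c : R) : open U -> smooth_on U (cst c).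
Proof. by move=> oU k; exact: Ck_cst. Qed.

Lemma smoothD U f g : open U -> smooth_on U f -> smooth_on U g ->
  smooth_on U (f + g).
Proof. by move=> oU sf sg k; exact: CkD (sf k) (sg k). Qed.

Lemma smoothN U f : open U -> smooth_on U f -> smooth_on U (- f).
Proof. by move=> oU sf k; exact: CkN (sf k). Qed.

Lemma smoothM U f g : open U -> smooth_on U f -> smooth_on U g ->
  smooth_on U (f * g).
Proof. by move=> oU sf sg k; exact: CkM (sf k) (sg k). Qed.

Lemma smooth_sum U (F : 'I_d -> V -> R) : open U ->
  (forall i, smooth_on U (F i)) -> smooth_on U (\sum_i F i).
Proof.
move=> oU sF; elim/big_ind: _ => //; first exact: smooth_cst.
by move=> f g; exact: smoothD.
Qed.

Lemma smooth_partial U f i : smooth_on U f -> smooth_on U (partial i f).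
Proof. by move=> sf k; have [_] := sf k.+1; apply. Qed.

Lemma smooth_differentiable U f x : smooth_on U f -> U x -> differentiable f x.
Proof. by move=> /(_ 1%N)[df _] Ux; apply: df. Qed.

Lemma smooth_derivable U f x v : smooth_on U f -> U x -> derivable f x v.
Proof. by move=> sf Ux; exact/diff_derivable/(smooth_differentiable sf). Qed.

Lemma smooth_continuous U f x : smooth_on U f -> U x -> {for x, continuous f}.
Proof. by move=> sf Ux; apply: (sf 0%N). Qed.

Lemma is_derive_line f (x u : V) (s : R) : differentiable f (x + s *: u) ->
  is_derive s 1 (fun t : R => f (x + t *: u)) ('D_u f (x + s *: u)).
Proof.
move=> df.
have dl : is_diff s (fun t : R => x + t *: u) (fun t : R => t *: u).
  have := is_diffD (is_diff_cst x s) (is_diff_scalel s u).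
  by rewrite add0r.
case: (dl) => dld dlv.
have dc : differentiable (f \o (fun t : R => x + t *: u)) s.
  exact: differentiable_comp.
split; first exact/diff_derivable.
by rewrite deriveE// diff_comp// dlv /= scale1r deriveE.
Qed.

Lemma second_difference U f (x u v : V) (t : R) : 0 < t ->
  (forall y, `|y - x| <= t * (`|u| + `|v|) -> U y) ->
  (forall y, U y -> differentiable f y) ->
  (forall y, U y -> differentiable (fun z => 'D_u f z) y) ->
  exists2 y, `|y - x| <= t * (`|u| + `|v|) &
    f (x + t *: u + t *: v) - f (x + t *: u) - f (x + t *: v) + f x =
    t * t * 'D_v (fun z => 'D_u f z) y.
Proof.
move=> t0 Ub df ddf.
have bnd a b : 0 <= a <= t -> 0 <= b <= t ->
    `|x + a *: u + b *: v - x| <= t * (`|u| + `|v|).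
  move=> /andP[a0 at_] /andP[b0 bt]; rewrite -[x + _ + _]addrA (addrC x) addrK.
  rewrite (le_trans (ler_normD _ _))// mulrDr !normrZ !ger0_norm//.
  by rewrite lerD// ler_wpM2r.
have tt : 0 <= t <= t by rewrite ltW/=.
have z0 : 0 <= (0 : R) <= t by rewrite lexx ltW.
have dline1 b s : 0 <= b <= t -> 0 <= s <= t ->
    is_derive s 1 (fun a => f (x + a *: u + b *: v)) ('D_u f (x + s *: u + b *: v)).
  move=> hb hs; have := @is_derive_line f (x + b *: v) u s.
  rewrite addrAC => /(_ (df _ (Ub _ (bnd _ _ hs hb)))).
  by under eq_fun do rewrite addrAC.
have isd s : 0 <= s <= t -> is_derive s 1
    (fun a => f (x + a *: u + t *: v) - f (x + a *: u + 0 *: v))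
    ('D_u f (x + s *: u + t *: v) - 'D_u f (x + s *: u + 0 *: v)).
  by move=> hs; apply: is_deriveB; exact: dline1.
have oo s : s \in `]0, t[ -> 0 <= s <= t.
  by rewrite in_itv => /andP[/ltW-> /ltW->].
have cc s : s \in `[0, t] -> 0 <= s <= t by rewrite in_itv.
have within_c (h dh : R -> R) :
    (forall s, 0 <= s <= t -> is_derive s 1 h (dh s)) ->
    {within `[0, t], continuous h}.
  move=> hd; apply: derivable_within_continuous => s /cc /hd.
  by move=> []. 
have [a /oo ha Ea] := MVT t0 (fun s hs => isd s (oo s hs)) (within_c _ _ isd).
have isd2 s : 0 <= s <= t -> is_derive s 1
    (fun b => 'D_u f (x + a *: u + b *: v))
    ('D_v (fun z => 'D_u f z) (x + a *: u + s *: v)).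
  by move=> hs; apply: is_derive_line; exact: ddf (Ub _ (bnd _ _ ha hs)).
have [b /oo hb Eb] := MVT t0 (fun s hs => isd2 s (oo s hs)) (within_c _ _ isd2).
exists (x + a *: u + b *: v); first exact: bnd.
move: Ea Eb; rewrite /= !scale0r !addr0 !subr0 => Ea Eb.
rewrite mulrC mulrA -Eb.
by rewrite -Ea opprB addrA addrAC.
Qed.

Lemma partialC U f i j x : open U -> smooth_on U f -> U x ->
  partial i (partial j f) x = partial j (partial i f) x.
Proof.
move=> oU sf Ux.
have cont (g : V -> R) (e : R) : 0 < e -> smooth_on U g -> \forall y \near x, `|g x - g y| < e.
  by move=> e0 sg; have /cvgrPdist_lt := smooth_continuous sg Ux; apply.
have sA := smooth_partial i (smooth_partial j sf).
have sB := smooth_partial j (smooth_partial i sf).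
move: sA sB; set A := partial i (partial j f); set B := partial j (partial i f) => sA sB.
suff main (e : R) : 0 < e -> `|A x - B x| <= e.
  apply/eqP; rewrite -subr_eq0 -normr_le0; apply/ler_addgt0Pl => e.
  by rewrite addr0; exact: main.
move=> e0.
have e2 : 0 < e / 2 by rewrite divr_gt0.
have nU : \forall y \near x, U y by exact: open_near oU Ux _.
have [r /= r0 rP] := iffLR (@nbhs_normP R V x _) (filterI (cont A _ e2 sA) (filterI (cont B _ e2 sB) nU)).
pose u : V := delta_mx 0 j; pose v : V := delta_mx 0 i.
pose m := `|u| + `|v| + 1.
have m0 : 0 < m by rewrite ltr_wpDl.
pose t := r / m / 2.
have t0 : 0 < t by rewrite !divr_gt0.
have tr : t * (`|u| + `|v|) < r.
  rewrite (@le_lt_trans _ _ (t * m))//; first by rewrite ler_wpM2l ?lerDl// ltW.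
  by rewrite /t mulrAC divfK ?gt_eqF// ltr_pdivrMr// ltr_pMr// ltr1n.
have inball y : `|y - x| <= t * (`|u| + `|v|) ->
    [/\ `|A x - A y| < e / 2, `|B x - B y| < e / 2 & U y].
  move=> h; have yr : `|x - y| < r by rewrite distrC; exact: le_lt_trans h tr.
  by case: (rP y yr) => hA [hB hU]; split.
have Ub y : `|y - x| <= t * (`|u| + `|v|) -> U y by case/inball.
have df y : U y -> differentiable f y by exact: smooth_differentiable.
have ddf k y : U y -> differentiable (partial k f) y.
  by apply: smooth_differentiable; exact: smooth_partial.
have [y hy Ey] := second_difference t0 Ub df (ddf j).
have Ub' w : `|w - x| <= t * (`|v| + `|u|) -> U w by rewrite [`|v| + _]addrC; exact: Ub.
have [z hz Ez] := second_difference t0 Ub' df (ddf i).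
have AB : A y = B z.
  apply: (@mulfI _ (t * t)); first by rewrite mulf_neq0 ?gt_eqF.
  rewrite /A /B /partial -Ey -Ez.
  by rewrite [x + t *: v + t *: u]addrAC; congr (_ + _); rewrite [LHS]addrAC.
rewrite [`|v| + _]addrC in hz.
have [Ay _ _] := inball _ hy; have [_ Bz _] := inball _ hz.
have -> : A x - B x = (A x - A y) - (B x - B z).
  by rewrite AB opprB addrA subrK.
apply: ltW; apply: le_lt_trans (ler_normB _ _) _.
rewrite (splitr e).
exact: ltrD Ay Bz.
Qed.

End SmoothEuclidean.

Section Manifolds.
Context {R : realType} {d : nat}.
Local Notation V := 'rV[R]_d.

Record chart (M : topologicalType) := Chart {
  chart_dom : set M;
  chart_img : set V;
  chart_fun : M -> V;
  chart_inv : V -> M;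
  chart_dom_open : open chart_dom;
  chart_img_open : open chart_img;
  chart_funP : forall p, chart_dom p -> chart_img (chart_fun p);
  chart_invP : forall x, chart_img x -> chart_dom (chart_inv x);
  chart_funK : forall p, chart_dom p -> chart_inv (chart_fun p) = p;
  chart_invK : forall x, chart_img x -> chart_fun (chart_inv x) = x;
  chart_fun_continuous : forall p, chart_dom p -> {for p, continuous chart_fun};
  chart_inv_continuous : forall x, chart_img x -> {for x, continuous chart_inv} }.

Record manifold := Manifold {
  carrier :> topologicalType;
  atlas : set (chart carrier);
  manifold_nonempty : [set: carrier] !=set0;
  manifold_hausdorff : hausdorff_space carrier;
  manifold_second_countable : @second_countable carrier;
  atlas_cover : forall p : carrier, exists2 c, atlas c & chart_dom c p;
  atlas_compatible : forall c c', atlas c -> atlas c' -> forall i : 'I_d,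
    smooth_on (chart_img c `&` chart_inv c @^-1` chart_dom c')
              (fun x => chart_fun c' (chart_inv c x) 0 i) }.

End Manifolds.
Arguments manifold R d : clear implicits.
Arguments chart_dom_open {R d M} c.
Arguments chart_img_open {R d M} c.

Section SmoothFunctions.
Context {R : realType} {d : nat} (M : manifold R d).

Definition smooth (f : M -> R) : Prop :=
  forall c, atlas c -> smooth_on (chart_img c) (f \o chart_inv c).

Record cinf := Cinf { cinf_fun :> M -> R; cinfP : smooth cinf_fun }.

Lemma cinf_inj (f g : cinf) : f =1 g -> f = g.
Proof.
case: f g => [f sf] [g sg] /= /funext fg; move: sg; rewrite -{}fg => sg.
by congr Cinf; exact: Prop_irrelevance.
Qed.

HB.instance Definition _ := gen_eqMixin cinf.
HB.instance Definition _ := gen_choiceMixin cinf.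

Definition cinf_cst (a : R) : cinf :=
  @Cinf (cst a) (fun c _ => smooth_cst a (chart_img_open c)).

Definition cinf_add (f g : cinf) : cinf :=
  @Cinf (fun p => f p + g p) (fun c hc =>
    smoothD (chart_img_open c) (cinfP f hc) (cinfP g hc)).

Definition cinf_opp (f : cinf) : cinf :=
  @Cinf (fun p => - f p) (fun c hc => smoothN (chart_img_open c) (cinfP f hc)).

Definition cinf_mul (f g : cinf) : cinf :=
  @Cinf (fun p => f p * g p) (fun c hc =>
    smoothM (chart_img_open c) (cinfP f hc) (cinfP g hc)).

Fact cinf_addA : associative cinf_add.
Proof. by move=> f g h; apply: cinf_inj => p /=; rewrite addrA. Qed.
Fact cinf_addC : commutative cinf_add.
Proof. by move=> f g; apply: cinf_inj => p /=; rewrite addrC. Qed.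
Fact cinf_add0 : left_id (cinf_cst 0) cinf_add.
Proof. by move=> f; apply: cinf_inj => p /=; rewrite add0r. Qed.
Fact cinf_addN : left_inverse (cinf_cst 0) cinf_opp cinf_add.
Proof. by move=> f; apply: cinf_inj => p /=; rewrite addNr. Qed.

HB.instance Definition _ :=
  GRing.isZmodule.Build cinf cinf_addA cinf_addC cinf_add0 cinf_addN.

Fact cinf_mulA : associative cinf_mul.
Proof. by move=> f g h; apply: cinf_inj => p /=; rewrite mulrA. Qed.
Fact cinf_mulC : commutative cinf_mul.
Proof. by move=> f g; apply: cinf_inj => p /=; rewrite mulrC. Qed.
Fact cinf_mul1 : left_id (cinf_cst 1) cinf_mul.
Proof. by move=> f; apply: cinf_inj => p /=; rewrite mul1r. Qed.
Fact cinf_mulDl : left_distributive cinf_mul +%R.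
Proof. by move=> f g h; apply: cinf_inj => p /=; rewrite mulrDl. Qed.
Fact cinf_one_neq0 : cinf_cst 1 != 0.
Proof.
have [p _] := manifold_nonempty M.
by apply/eqP => /(congr1 (fun f : cinf => f p)) /eqP; rewrite /= oner_eq0.
Qed.

HB.instance Definition _ := GRing.Zmodule_isComNzRing.Build cinf
  cinf_mulA cinf_mulC cinf_mul1 cinf_mulDl cinf_one_neq0.

End SmoothFunctions.

Section VectorFields.
Context {R : realType} {d : nat} (M : manifold R d).
Local Notation V := 'rV[R]_d.

(* A smooth vector field, seen as an operator on smooth functions that in each
   chart reads sum_i a^i d/dx^i with smooth components a^i. *)
Definition is_vfield (X : cinf M -> cinf M) : Prop :=
  forall c, atlas c -> exists a : 'I_d -> V -> R,
    (forall i, smooth_on (chart_img c) (a i)) /\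
    (forall (f : cinf M) x, chart_img c x ->
       X f (chart_inv c x) = \sum_i a i x * partial i (f \o chart_inv c) x).

Record vfield := VField { vf_act :> cinf M -> cinf M; vfieldP : is_vfield vf_act }.

Lemma vfield_inj (X Y : vfield) : (forall f, X f = Y f) -> X = Y.
Proof.
case: X Y => [X sX] [Y sY] /= /funext XY; move: sY; rewrite -{}XY => sY.
by congr VField; exact: Prop_irrelevance.
Qed.

HB.instance Definition _ := gen_eqMixin vfield.
HB.instance Definition _ := gen_choiceMixin vfield.

Fact vf_zero_subproof : is_vfield (fun=> 0).
Proof.
move=> c hc; exists (fun=> cst 0); split=> [i|f x Ux].
  exact/smooth_cst/chart_img_open.
by rewrite big1// => i _; rewrite mul0r.
Qed.
Definition vf_zero := VField vf_zero_subproof.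

Fact vf_add_subproof (X Y : vfield) : is_vfield (fun f => X f + Y f).
Proof.
move=> c hc; have [a [sa Xa]] := vfieldP X hc; have [b [sb Yb]] := vfieldP Y hc.
exists (fun i => a i + b i); split=> [i|f x Ux].
  exact: smoothD (chart_img_open c) (sa i) (sb i).
rewrite [LHS]/= Xa// Yb// -big_split/=.
by apply: eq_bigr => i _; rewrite -mulrDl.
Qed.
Definition vf_add X Y := VField (vf_add_subproof X Y).

Fact vf_opp_subproof (X : vfield) : is_vfield (fun f => - X f).
Proof.
move=> c hc; have [a [sa Xa]] := vfieldP X hc.
exists (fun i => - a i); split=> [i|f x Ux].
  exact: smoothN (chart_img_open c) (sa i).
rewrite [LHS]/= Xa// -sumrN.
by apply: eq_bigr => i _; rewrite -mulNr.
Qed.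
Definition vf_opp X := VField (vf_opp_subproof X).

Fact vf_scale_subproof (h : cinf M) (X : vfield) : is_vfield (fun f => h * X f).
Proof.
move=> c hc; have [a [sa Xa]] := vfieldP X hc.
exists (fun i => (h \o chart_inv c) * a i); split=> [i|f x Ux].
  exact: smoothM (chart_img_open c) (cinfP h hc) (sa i).
rewrite [LHS]/= Xa// mulr_sumr.
by apply: eq_bigr => i _; rewrite mulrA.
Qed.
Definition vf_scale h X := VField (vf_scale_subproof h X).

Fact vf_bracket_subproof (X Y : vfield) : is_vfield (fun f => X (Y f) - Y (X f)).
Proof.
move=> c hc; have [a [sa Xa]] := vfieldP X hc; have [b [sb Yb]] := vfieldP Y hc.
have oU := chart_img_open c; set U := chart_img c in oU sa Xa sb Yb *.
exists (fun i => \sum_j (a j * partial j (b i) - b j * partial j (a i))).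
split=> [i|f x Ux].
  apply: smooth_sum => // j; apply: smoothD => //; last apply: smoothN => //.
    by apply: smoothM => //; exact: smooth_partial.
  by apply: smoothM => //; exact: smooth_partial.
have sF := cinfP f hc; set F := f \o chart_inv c in sF *.
have iter (Z W : vfield) (u w : 'I_d -> V -> R) :
    (forall i, smooth_on U (w i)) ->
    (forall (g : cinf M) y, U y ->
       Z g (chart_inv c y) = \sum_i u i y * partial i (g \o chart_inv c) y) ->
    (forall (g : cinf M) y, U y ->
       W g (chart_inv c y) = \sum_i w i y * partial i (g \o chart_inv c) y) ->
    Z (W f) (chart_inv c x) =
    \sum_i \sum_j (u j x * partial j (w i) x * partial i F x) +
    \sum_i \sum_j (w i x * u j x * partial j (partial i F) x).
  move=> sw Zu Ww; rewrite Zu//.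
  have E j : partial j (W f \o chart_inv c) x =
      \sum_i (w i x * partial j (partial i F) x + partial i F x * partial j (w i) x).
    rewrite (@partial_ext _ _ U _ (\sum_i w i * partial i F))//; last first.
      by move=> y Uy /=; rewrite Ww// fct_sumE.
    have dw i : derivable (w i) x (delta_mx 0 j) by exact: smooth_derivable (sw i) Ux.
    have dF i : derivable (partial i F) x (delta_mx 0 j).
      exact: smooth_derivable (smooth_partial i sF) Ux.
    rewrite /partial derive_sum; last first.
      by move=> i; apply: derivableM; [exact: dw|exact: dF].
    by apply: eq_bigr => i _; rewrite (deriveM (dw i) (dF i)).
  rewrite -big_split/=; under eq_bigr => j _ do rewrite E mulr_sumr.
  rewrite exchange_big/=; apply: eq_bigr => i _.
  by rewrite -big_split/=; apply: eq_bigr => j _; ring.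
rewrite [LHS]/= (iter X Y a b)// (iter Y X b a)//.
rewrite opprD addrACA [X in _ + X](_ : _ = 0) ?addr0; last first.
  apply/eqP; rewrite subr_eq0; apply/eqP; rewrite exchange_big/=.
  apply: eq_bigr => i _; apply: eq_bigr => j _.
  by rewrite (partialC i j oU sF Ux); congr (_ * _); rewrite mulrC.
rewrite -sumrB; apply: eq_bigr => i _; rewrite -sumrB fct_sumE mulr_suml.
by apply: eq_bigr => j _; rewrite !fctE mulrBl.
Qed.

(* [X, Y] f = X (Y f) - Y (X f) *)
Definition vf_bracket X Y := VField (vf_bracket_subproof X Y).

Fact vf_addA : associative vf_add.
Proof. by move=> X Y Z; apply: vfield_inj => f /=; rewrite addrA. Qed.
Fact vf_addC : commutative vf_add.
Proof. by move=> X Y; apply: vfield_inj => f /=; rewrite addrC. Qed.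
Fact vf_add0 : left_id vf_zero vf_add.
Proof. by move=> X; apply: vfield_inj => f /=; rewrite add0r. Qed.
Fact vf_addN : left_inverse vf_zero vf_opp vf_add.
Proof. by move=> X; apply: vfield_inj => f /=; rewrite addNr. Qed.

HB.instance Definition _ :=
  GRing.isZmodule.Build vfield vf_addA vf_addC vf_add0 vf_addN.

Fact vf_scaleA g h X : vf_scale g (vf_scale h X) = vf_scale (g * h) X.
Proof. by apply: vfield_inj => f /=; rewrite mulrA. Qed.
Fact vf_scale1 : left_id 1 vf_scale.
Proof. by move=> X; apply: vfield_inj => f /=; rewrite mul1r. Qed.
Fact vf_scaleDr : right_distributive vf_scale +%R.
Proof. by move=> h X Y; apply: vfield_inj => f /=; rewrite mulrDr. Qed.
Fact vf_scaleDl X : {morph vf_scale^~ X : g h / g + h}.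
Proof. by move=> g h; apply: vfield_inj => f /=; rewrite mulrDl. Qed.

HB.instance Definition _ := GRing.Zmodule_isLmodule.Build (cinf M) vfield
  vf_scaleA vf_scale1 vf_scaleDr vf_scaleDl.

End VectorFields.

Section RiemannianGeometry.
Context {R : realType} {d : nat} {M : manifold R d}.
Implicit Types (X Y Z W : vfield M) (f : cinf M).

(* Smooth tensor fields are maps that are linear over the smooth functions. *)
Definition one_form := {scalar vfield M}.
Definition endo_field := {linear vfield M -> vfield M}.

(* The tangent vector X_p vanishes iff X f p = 0 for every smooth f. *)
Record riemannian_metric := RiemannianMetric {
  metric :> vfield M -> vfield M -> cinf M;
  metric_linear : forall X, scalar (metric X);
  metric_sym : forall X Y, metric X Y = metric Y X;
  metric_ge0 : forall X p, 0 <= metric X X p;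
  metric_definite : forall X p, metric X X p = 0 <-> (forall f, X f p = 0) }.

Record connection := Connection {
  nabla :> vfield M -> vfield M -> vfield M;
  nabla_linear : forall Y, linear (nabla ^~ Y);
  nabla_additive : forall X, {morph nabla X : Y Z / Y + Z};
  nabla_leibniz : forall X f Y, nabla X (f *: Y) = X f *: Y + f *: nabla X Y }.

Definition levi_civita (g : riemannian_metric) (D : connection) : Prop :=
  (forall X Y, D X Y - D Y X = vf_bracket X Y) /\
  (forall X Y Z, X (g Y Z) = g (D X Y) Z + g Y (D X Z)).

Definition curvature (D : connection) X Y Z : vfield M :=
  D X (D Y Z) - D Y (D X Z) - D (vf_bracket X Y) Z.

Definition flat (D : connection) : Prop := forall X Y Z, curvature D X Y Z = 0.

(* (nabla_W R)(X, Y) Z *)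
Definition nabla_curvature (D : connection) W X Y Z : vfield M :=
  D W (curvature D X Y Z) - curvature D (D W X) Y Z
  - curvature D X (D W Y) Z - curvature D X Y (D W Z).

Definition ext_deriv (eta : one_form) X Y : cinf M :=
  cinf_cst M 2^-1 * (X (eta Y) - Y (eta X) - eta (vf_bracket X Y)).

(* (L_X T) Y *)
Definition lie_endo X (T : endo_field) Y : vfield M :=
  vf_bracket X (T Y) - T (vf_bracket X Y).

End RiemannianGeometry.
Arguments one_form {R d} M.
Arguments endo_field {R d} M.
Arguments riemannian_metric {R d} M.
Arguments connection {R d} M.

Section ContactMetric.
Context {R : realType} {n : nat} {M : manifold R n.*2.+1}.
Implicit Types X Y Z W : vfield M.

(* eta /\ (d eta)^n on (E_0, ..., E_2n), up to a positive constant depending on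
   the normalization of the wedge product *)
Definition contact_volume (eta : one_form M) (E : 'I_n.*2.+1 -> vfield M) : cinf M :=
  \sum_(s : 'S_n.*2.+1) (-1) ^+ s * eta (E (s ord0)) *
    \prod_(i < n) ext_deriv eta (E (s (inord i.*2.+1))) (E (s (inord i.*2.+2))).

Record contact_metric := ContactMetric {
  phi : endo_field M;
  xi : vfield M;
  eta : one_form M;
  cm_metric : riemannian_metric M;
  contactP : forall p, exists E, contact_volume eta E p != 0;
  eta_xi : eta xi = 1;
  phi_phi : forall X, phi (phi X) = - X + eta X *: xi;
  metric_phi : forall X Y,
    cm_metric (phi X) (phi Y) = cm_metric X Y - eta X * eta Y;
  ext_deriv_eta : forall X Y, ext_deriv eta X Y = cm_metric X (phi Y) }.

Definition h_endo (S : contact_metric) X : vfield M :=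
  cinf_cst M 2^-1 *: lie_endo (xi S) (phi S) X.

Definition is_kappa_mu (S : contact_metric) (D : connection M) (kappa mu : R) : Prop :=
  forall X Y, curvature D X Y (xi S) =
    cinf_cst M kappa *: (eta S Y *: X - eta S X *: Y)
    + cinf_cst M mu *: (eta S Y *: h_endo S X - eta S X *: h_endo S Y).

Definition phi_recurrent (S : contact_metric) (D : connection M) : Prop :=
  exists2 A : one_form M, (exists W, A W != 0) &
    forall X Y Z W,
      phi S (phi S (nabla_curvature D W X Y Z)) = A W *: curvature D X Y Z.

End ContactMetric.
Arguments contact_metric {R} n M.

(* Main.v *)
From mathcomp Require Import all_boot all_order all_algebra.
From mathcomp Require Import all_classical all_reals all_analysis.
From mathcomp Require Import ring lra.
Require Import Defs.

(** Write [B X] for the covariant derivative of [xi] along [X] and [h] for half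
    the Lie derivative of [phi] along [xi].

    A phi-recurrent structure has [A W *: R(X, Y) Z] in the image of [phi], hence
    orthogonal to [xi].  At a point where [A W <> 0], pairing with [xi] and taking
    [X = xi] turns the (kappa, mu)-condition into
    [kappa * g(phi Y, phi Z) + mu * g(h Y, Z) = 0].  The first term is invariant
    and the second one changes sign when [Y], [Z] are replaced by [phi Y],
    [phi Z], so both vanish there.  The contact condition provides a [Y] with
    [phi Y <> 0] at the point, so [kappa = 0]; then [h^2 = - phi^2], so that
    [h Y <> 0] and [mu = 0] (lemma [phi_recurrent_kappa_mu0]).  As [kappa] and
    [mu] are constants, [R(X, Y) xi = 0] on all of [M].

    It remains to see that a contact metric three-manifold with
    [R(X, Y) xi = 0] is flat (lemma [xi_flat_flat]).  The endomorphism [h] has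
    the eigenvalues [1] and [-1] on the contact distribution; [phi] exchanges the
    two eigenbundles, and [B] is [-2 phi] on the first one and zero on the second
    one.  Expanding [R(X, Y) xi = 0] on eigenfields shows that the (-1)-bundle is
    preserved by derivatives along itself and along [xi], and that for fields
    [X], [Y], [W] of the (+1)-bundle [g(D X (phi Y), W)] is symmetric in [X], [Y]
    and skew in [X], [W], hence zero.  So a derivative of a (-1)-field never has a
    component in the (+1)-bundle (lemma [nabla_minus_plus]), which kills the
    curvature components mixing the two bundles.  All of this holds in any
    dimension; in dimension three both bundles are lines, so that [R(X, Y) = 0]
    when [X], [Y] lie in the same one.

    Every computation takes place in the module of vector fields over the ring of
    smooth functions.  The one thing that has to be seen in a chart, besides the
    rules of derivation, is that four tangent vectors of a three-manifold are dependent.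
    Conversely, on a flat manifold the form [eta] itself serves as the recurrence
    form. *)

Set Implicit Arguments.
Unset Strict Implicit.
Unset Printing Implicit Defensive.
Import Order.TTheory GRing.Theory Num.Theory.
Import numFieldNormedType.Exports.

(** * Vector fields as derivations *)

Section Derivations.
Local Open Scope ring_scope.
Context {R : realType} {d : nat} {M : manifold R d}.
Implicit Types (X Y Z : vfield M) (f g : cinf M) (p : M).

Lemma cinfDE f g p : (f + g) p = f p + g p. Proof. by []. Qed.
Lemma cinfNE f p : (- f) p = - f p. Proof. by []. Qed.
Lemma cinfME f g p : (f * g) p = f p * g p. Proof. by []. Qed.
Lemma cinf0E p : (0 : cinf M) p = 0. Proof. by []. Qed.
Lemma cinf1E p : (1 : cinf M) p = 1. Proof. by []. Qed.
Definition cinfE := (cinfDE, cinfNE, cinfME, cinf0E, cinf1E).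

Lemma cinf_half : cinf_cst M 2^-1 + cinf_cst M 2^-1 = 1.
Proof. by apply: cinf_inj => p /=; rewrite [RHS]splitr mul1r. Qed.

Lemma cinf_halfK f : cinf_cst M 2^-1 * (f + f) = f.
Proof. by rewrite mulrDr -mulrDl cinf_half mul1r. Qed.

Lemma cinf_double_eq0 f : f + f = 0 -> f = 0.
Proof. by move=> ff; rewrite -(cinf_halfK f) ff mulr0. Qed.

Lemma cinf_double_inj f g : f + f = g + g -> f = g.
Proof. by move=> fg; rewrite -(cinf_halfK f) fg cinf_halfK. Qed.

(** All vector fields are expanded in one and the same chart at [p], which is what
    allows dependent tangent vectors to be found among several of them. *)
Lemma vf_chart p : exists c x, [/\ atlas c, chart_img c x, chart_inv c x = p &
  forall X, exists a : 'I_d -> R, forall f,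
    X f p = \sum_i a i * partial i (f \o chart_inv c) x].
Proof.
have [c hc pc] := atlas_cover p; exists c, (chart_fun c p).
have Ux := chart_funP pc; split=> // [|X]; first exact: chart_funK.
have [a [_ Xa]] := vfieldP X hc; exists (fun i => a i (chart_fun c p)) => f.
by rewrite -[in LHS](chart_funK pc) Xa.
Qed.

Lemma vf_actD X f g : X (f + g) = X f + X g.
Proof.
apply: cinf_inj => p; have [c [x [hc Ux _]]] := vf_chart p.
move=> /(_ X)[a Xa]; rewrite cinfDE !Xa -big_split/=; apply: eq_bigr => i _.
rewrite -mulrDr; congr (_ * _).
by apply: deriveD; [exact: smooth_derivable (cinfP f hc) Ux|
                    exact: smooth_derivable (cinfP g hc) Ux].
Qed.

Lemma vf_actM X f g : X (f * g) = X f * g + f * X g.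
Proof.
apply: cinf_inj => p; have [c [x [hc Ux xp]]] := vf_chart p.
move=> /(_ X)[a Xa]; rewrite cinfDE !cinfME !Xa mulr_suml mulr_sumr -big_split/=.
apply: eq_bigr => i _.
rewrite [partial i ((f * g) \o _) x](_ : _ = f p * partial i (g \o chart_inv c) x
   + g p * partial i (f \o chart_inv c) x); first by ring.
rewrite -xp; apply: deriveM; first exact: smooth_derivable (cinfP f hc) Ux.
exact: smooth_derivable (cinfP g hc) Ux.
Qed.

Lemma vf_act_cst X a : X (cinf_cst M a) = 0.
Proof.
apply: cinf_inj => p; have [c [x [hc Ux xp]]] := vf_chart p.
move=> /(_ X)[b Xb]; rewrite Xb big1// => i _.
by rewrite [partial _ _ _]partial_cst mulr0.
Qed.

Lemma vf_act0 X : X 0 = 0. Proof. exact: (vf_act_cst X 0). Qed.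
Lemma vf_act1 X : X 1 = 0. Proof. exact: (vf_act_cst X 1). Qed.

Lemma vf_actN X f : X (- f) = - X f.
Proof. by apply/eqP; rewrite -addr_eq0 -vf_actD addNr vf_act0. Qed.

Lemma vf_bracketE X Y f : vf_bracket X Y f = X (Y f) - Y (X f).
Proof. by []. Qed.
Lemma vfDE X Y f : (X + Y) f = X f + Y f. Proof. by []. Qed.
Lemma vf0E f : (0 : vfield M) f = 0. Proof. by []. Qed.
Lemma vfNE X f : (- X) f = - X f. Proof. by []. Qed.
Lemma vfZE g X f : (g *: X) f = g * X f. Proof. by []. Qed.

Lemma vf_bracketC X Y : vf_bracket X Y = - vf_bracket Y X.
Proof. by apply: vfield_inj => f; rewrite vfNE !vf_bracketE opprB. Qed.

Lemma vf_bracketDl X Y Z : vf_bracket (X + Y) Z = vf_bracket X Z + vf_bracket Y Z.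
Proof.
by apply: vfield_inj => f; rewrite vfDE !vf_bracketE !vfDE vf_actD; ring.
Qed.

Lemma vf_bracketZl f X Y :
  vf_bracket (f *: X) Y = f *: vf_bracket X Y - Y f *: X.
Proof.
apply: vfield_inj => k; rewrite vfDE vfNE !vfZE !vf_bracketE !vfZE vf_actM.
by ring.
Qed.

Lemma vf_jacobi X Y Z : vf_bracket X (vf_bracket Y Z) +
  vf_bracket Y (vf_bracket Z X) + vf_bracket Z (vf_bracket X Y) = 0.
Proof.
apply: vfield_inj => f; rewrite !vfDE vf0E !vf_bracketE.
by rewrite !(vf_actD, vf_actN); ring.
Qed.

End Derivations.

(** * Pointwise consequences of the metric *)

Section Metric.
Local Open Scope ring_scope.
Context {R : realType} {d : nat} {M : manifold R d} (g : riemannian_metric M).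
Implicit Types (X Y Z W : vfield M) (f : cinf M) (p : M).

Lemma metricDr X Y Z : g X (Y + Z) = g X Y + g X Z.
Proof. by have := metric_linear g X 1 Y Z; rewrite scale1r mul1r. Qed.
Lemma metric0r X : g X 0 = 0.
Proof. by apply: (@addrI _ (g X 0)); rewrite -metricDr !addr0. Qed.
Lemma metricZr X f Y : g X (f *: Y) = f * g X Y.
Proof. by have := metric_linear g X f Y 0; rewrite metric0r !addr0. Qed.
Lemma metricNr X Y : g X (- Y) = - g X Y.
Proof. by rewrite -scaleN1r metricZr mulN1r. Qed.
Lemma metricDl X Y Z : g (X + Y) Z = g X Z + g Y Z.
Proof. by rewrite metric_sym metricDr !(metric_sym g Z). Qed.
Lemma metric0l X : g 0 X = 0.
Proof. by rewrite metric_sym metric0r. Qed.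
Lemma metricZl f X Y : g (f *: X) Y = f * g X Y.
Proof. by rewrite metric_sym metricZr (metric_sym g Y). Qed.
Lemma metricNl X Y : g (- X) Y = - g X Y.
Proof. by rewrite metric_sym metricNr (metric_sym g Y). Qed.
Definition metricE := (metricDr, metricDl, metricZr, metricZl, metricNr, metricNl,
  metric0r, metric0l).

Lemma metric_eq0 X : (forall Z, g X Z = 0) -> X = 0.
Proof.
move=> X0; apply: vfield_inj => f; apply: cinf_inj => p.
by apply: (iffLR (metric_definite g X p)); rewrite X0.
Qed.

Lemma metric_inj X Y : (forall Z, g X Z = g Y Z) -> X = Y.
Proof.
move=> XY; apply/eqP; rewrite -subr_eq0; apply/eqP/metric_eq0 => Z.
by rewrite !metricE XY subrr.
Qed.

(** The pointwise Cauchy-Schwarz inequality in the degenerate case.  It stands in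
    for locality: a tensor that can be moved across [g] vanishes wherever its
    argument does. *)
Lemma metric_null X Y p : g X X p = 0 -> g X Y p = 0.
Proof.
move=> X0; apply: contrapT => /eqP b0.
(* [t] makes [g (Y + t X) (Y + t X) p = g Y Y p + 2 t b] equal to [-1]. *)
set b := g X Y p in b0; pose t := - (g Y Y p + 1) / (2 * b).
have := metric_ge0 g (Y + cinf_cst M t *: X) p.
rewrite !metricE (metric_sym g Y X) !cinfE X0 -/b.
rewrite [X in _ <= X](_ : _ = -1) ?ler0N1// [cinf_cst M t p]/= /t.
by field.
Qed.

(** Dependence among [d + 1] tangent vectors at [p], phrased through [g]: their
    components in a chart form a matrix with more rows than columns. *)
Lemma metric_dependent (E : 'I_d.+1 -> vfield M) p :
  exists2 c : 'I_d.+1 -> R, (exists i, c i != 0) &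
    forall Y, \sum_i c i * g (E i) Y p = 0.
Proof.
have [ch [x [_ _ _ loc]]] := vf_chart p.
have [a aE] := choice (fun i => loc (E i)).
pose A : 'M[R]_(d.+1, d) := \matrix_(i, j) a i j.
have : kermx A != 0.
  by rewrite -mxrank_eq0 mxrank_ker subn_eq0 -ltnNge ltnS rank_leq_col.
case/rowV0Pn=> c /sub_kermxP cA /rV0Pn[i ci].
exists (c 0) => [|Y]; first by exists i.
pose V : vfield M := \sum_i cinf_cst M (c 0 i) *: E i.
have VE f : V f p = \sum_i c 0 i * E i f p.
  rewrite /V; elim/big_rec2: _ => // j u W _ uW.
  by rewrite vfDE cinfDE uW.
have V0 f : V f p = 0.
  rewrite VE; under eq_bigr => j _ do rewrite aE mulr_sumr.
  rewrite exchange_big big1//= => k _; under eq_bigr => j _ do rewrite mulrA.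
  rewrite -mulr_suml; have := congr1 (fun B : 'rV_d => B 0 k) cA.
  rewrite !mxE; under eq_bigr => j _ do rewrite mxE.
  by move=> ->; rewrite mul0r.
have := metric_null Y (iffRL (metric_definite g V p) V0).
move=> VY; rewrite -[RHS]VY /V; elim/big_rec2: _ => [|j u W _ uW].
  by rewrite metric0l.
by rewrite metricDl metricZl !cinfE uW.
Qed.

End Metric.

(** * The curvature tensor of the Levi-Civita connection *)

Section Curvature.
Local Open Scope ring_scope.
Context {R : realType} {d : nat} {M : manifold R d}.
Context (g : riemannian_metric M) (D : connection M).
Implicit Types (X Y Z W : vfield M) (f : cinf M) (p : M).

Lemma nablaDl X Y Z : D (X + Y) Z = D X Z + D Y Z.
Proof. by have := nabla_linear D Z 1 X Y; rewrite !scale1r. Qed.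
Lemma nabla0l Z : D 0 Z = 0.
Proof. by apply: (@addrI _ (D 0 Z)); rewrite -nablaDl !addr0. Qed.
Lemma nablaZl f X Z : D (f *: X) Z = f *: D X Z.
Proof. by have := nabla_linear D Z f X 0; rewrite nabla0l !addr0. Qed.
Lemma nablaNl X Z : D (- X) Z = - D X Z.
Proof. by rewrite -scaleN1r nablaZl scaleN1r. Qed.
Lemma nablaDr X Y Z : D X (Y + Z) = D X Y + D X Z.
Proof. exact: nabla_additive. Qed.
Lemma nabla0r X : D X 0 = 0.
Proof. by apply: (@addrI _ (D X 0)); rewrite -nablaDr !addr0. Qed.
Lemma nablaNr X Y : D X (- Y) = - D X Y.
Proof. by apply/eqP; rewrite -addr_eq0 -nablaDr addNr nabla0r. Qed.
Definition nablaE := (nablaDl, nablaDr, nablaNl, nablaNr, nabla0l, nabla0r).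

Lemma curvatureC X Y Z : curvature D X Y Z = - curvature D Y X Z.
Proof.
rewrite /curvature (vf_bracketC X Y) nablaNl opprK !opprB.
by rewrite addrC.
Qed.

Lemma curvatureD X X' Y Z :
  curvature D (X + X') Y Z = curvature D X Y Z + curvature D X' Y Z.
Proof.
rewrite /curvature vf_bracketDl.
rewrite !nablaDl nablaDr; apply: (metric_inj (g := g)) => W.
by rewrite !metricE; ring.
Qed.

Lemma curvatureZ f X Y Z : curvature D (f *: X) Y Z = f *: curvature D X Y Z.
Proof.
rewrite /curvature vf_bracketZl.
rewrite !nablaDl nablaNl !nablaZl nabla_leibniz; apply: (metric_inj (g := g)) => W.
by rewrite !metricE; ring.
Qed.

Hypothesis LC : levi_civita g D.

Lemma torsion_free X Y : vf_bracket X Y = D X Y - D Y X.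
Proof. by case: LC. Qed.
Lemma metric_compat X Y Z : X (g Y Z) = g (D X Y) Z + g Y (D X Z).
Proof. by case: LC. Qed.

Lemma curvature_skew X Y Z W : g (curvature D X Y Z) W = - g Z (curvature D X Y W).
Proof.
have := vf_bracketE X Y (g Z W).
rewrite !metric_compat !vf_actD !metric_compat /curvature !metricE => H.
apply: subr0_eq.
set a := g (D (vf_bracket X Y) Z) W in H *; set b := g Z (D (vf_bracket X Y) W) in H *.
transitivity (a + b - (a + b)); last by rewrite subrr.
by rewrite {1}H; ring.
Qed.

Lemma bianchi X Y Z :
  curvature D X Y Z + curvature D Y Z X + curvature D Z X Y = 0.
Proof.
have T U V W : D U (D V W) - D U (D W V) - D (vf_bracket V W) U = vf_bracket U (vf_bracket V W).
  by rewrite (torsion_free U (vf_bracket V W)) (torsion_free V W) !nablaE.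
rewrite -[RHS](vf_jacobi X Y Z) -!T /curvature; apply: (metric_inj (g := g)) => W.
by rewrite !metricE; ring.
Qed.

(** The four Bianchi identities obtained by singling out one of [X], [Y], [Z], [W]
    add up, with signs, to twice this equation. *)
Lemma curvature_pair X Y Z W :
  g (curvature D X Y Z) W = g (curvature D Z W X) Y.
Proof.
have C A B E F : g (curvature D A B E) F = - g (curvature D B A E) F.
  by rewrite curvatureC metricNl.
have S A B E F : g (curvature D A B E) F = - g (curvature D A B F) E.
  by rewrite curvature_skew metric_sym.
have B A B E F : g (curvature D A B E) F + g (curvature D B E A) F +
    g (curvature D E A B) F = 0.
  by rewrite -!metricDl bianchi metric0l.
apply: cinf_double_inj; apply: subr0_eq.
have := B X Y Z W; have := B Y Z W X; have := B Z W X Y; have := B W X Y Z.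
(* By skewness the twelve terms reduce to six. *)
rewrite (S Y Z W X) (S Z W Y X) (C W Y Z X) (C W X Z Y) (S X W Z Y) (C X Z W Y)
  (S Z X W Y) (C W X Y Z) (S X Y W Z) (S Y W X Z).
set a := g (curvature D X Y Z) W; set a' := g (curvature D Z W X) Y.
set b := g (curvature D X W Y) Z; set b' := g (curvature D Y Z X) W.
set c := g (curvature D Z X Y) W; set c' := g (curvature D Y W Z) X.
move=> H4 H3 H2 H1.
(* Each zero is replaced by the left-hand side of one of the identities. *)
transitivity (0 + 0 - 0 - 0 : cinf M); last by rewrite !subr0 addr0.
by rewrite -{1}H1 -{1}H2 -{1}H3 -{1}H4; ring.
Qed.

End Curvature.

(** * Contact metric structures *)

Lemma eq_subr0 (V : zmodType) (a b : V) : a = b -> (a - b = 0)%R.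
Proof. by move=> ->; rewrite subrr. Qed.

Section ContactMetricGeometry.
Local Open Scope ring_scope.
Context {R : realType} {n : nat} {M : manifold R n.*2.+1} (S : contact_metric n M).
Implicit Types (X Y Z W : vfield M) (f : cinf M) (p : M).
Local Notation g := (cm_metric S).
Local Notation phi := (phi S).
Local Notation xi := (xi S).
Local Notation eta := (eta S).
Local Notation h := (h_endo S).

Lemma phiD X Y : phi (X + Y) = phi X + phi Y. Proof. exact: raddfD. Qed.
Lemma phiN X : phi (- X) = - phi X. Proof. exact: raddfN. Qed.
Lemma phiZ f X : phi (f *: X) = f *: phi X. Proof. exact: linearZ. Qed.
Lemma etaD X Y : eta (X + Y) = eta X + eta Y. Proof. exact: raddfD. Qed.
Lemma etaN X : eta (- X) = - eta X. Proof. exact: raddfN. Qed.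
Lemma etaZ f X : eta (f *: X) = f * eta X. Proof. exact: linearZ. Qed.

Lemma metric_phi_skew X Y : g (phi X) Y = - g X (phi Y).
Proof.
rewrite -(ext_deriv_eta S X Y) metric_sym -(ext_deriv_eta S Y X) /ext_deriv.
by rewrite (vf_bracketC Y X) raddfN; ring.
Qed.

(** [phi^2] kills [xi], so that [phi xi] is a multiple [f xi], where [f^2 = 0]. *)
Lemma phi_xi : phi xi = 0.
Proof.
have pp0 : phi (phi xi) = 0 by rewrite phi_phi eta_xi scale1r addNr.
have := phi_phi S (phi xi); rewrite {1}pp0 raddf0.
move/eqP; rewrite eq_sym addrC subr_eq0 => /eqP xiE.
suff f0 : eta (phi xi) = 0 by rewrite -xiE f0 scale0r.
have : eta (phi (eta (phi xi) *: xi)) = 0 by rewrite xiE pp0 raddf0.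
rewrite !linearZ/= => ff; apply: cinf_inj => p.
have /eqP := congr1 (fun f : cinf M => f p) ff.
by rewrite cinfME mulf_eq0 orbb => /eqP.
Qed.

Lemma metric_xi X : g X xi = eta X.
Proof.
have := metric_phi S X xi; rewrite phi_xi eta_xi mulr1 metric0r.
by move/eqP; rewrite eq_sym subr_eq0 => /eqP.
Qed.

Lemma eta_phi X : eta (phi X) = 0.
Proof. by rewrite -metric_xi metric_phi_skew phi_xi metric0r oppr0. Qed.

Lemma phi_phi_phi X : phi (phi (phi X)) = - phi X.
Proof. by rewrite phi_phi eta_phi scale0r addr0. Qed.

(** This is the form in which the contact condition enters: were [phi] zero at [p],
    the two-form [d eta] would be as well, and so would the contact volume. *)
Lemma contact_nonnull p : (0 < n)%N -> exists X, g (phi X) (phi X) p != 0.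
Proof.
move=> n0; have [E Ep] := contactP S p; apply: contrapT => H.
have dz X Y : ext_deriv eta X Y p = 0.
  rewrite ext_deriv_eta metric_sym; apply: metric_null.
  by apply: contrapT => /eqP ne; apply: H; exists Y.
move/negP: Ep; apply; apply/eqP.
rewrite /contact_volume; elim/big_rec: _ => // s f _ fp.
rewrite cinfDE fp addr0 (bigD1 (Ordinal n0))//.
set e := ext_deriv _ _ _; have ep : e p = 0 by exact: dz.
move: e ep => e ep.
by rewrite !cinfME ep mul0r mulr0.
Qed.

Context (D : connection M).
Hypothesis LC : levi_civita g D.

Local Notation B X := (D X xi).

(** The exterior derivative of [eta = g xi] is the skew part of [D xi]. *)
Lemma nabla_xi_skew_part X Y : g (B X) Y - g (B Y) X = g X (phi Y) + g X (phi Y).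
Proof.
rewrite -(ext_deriv_eta S X Y) /ext_deriv -!mulrDl cinf_half mul1r.
rewrite -!metric_xi !(metric_compat LC) (torsion_free LC) !metricE.
by rewrite (metric_sym g X) (metric_sym g Y); ring.
Qed.

Lemma eta_nabla_xi X : eta (B X) = 0.
Proof.
have : X (g xi xi) = 0 by rewrite metric_xi eta_xi vf_act1.
rewrite (metric_compat LC) (metric_sym _ xi) metric_xi.
exact: cinf_double_eq0.
Qed.

Lemma nabla_xi_xi : B xi = 0.
Proof.
apply: (metric_eq0 (g := g)) => X; have := nabla_xi_skew_part xi X.
rewrite metric_xi eta_nabla_xi subr0 => ->.
by rewrite -[g xi _]opprK -metric_phi_skew phi_xi metric0l oppr0 addr0.
Qed.

(** [shape] is the symmetric part of [X |-> D X xi]; it turns out to be [- phi h]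
    (see [h_shape]), and the later sections use it instead of [h].  It is locked
    because a visible sum would be expanded by the linearity rules of [g]. *)
Definition shape X := locked (B X + phi X).
Local Notation A := shape.

Lemma shapeE X : A X = B X + phi X.
Proof. by rewrite /A -lock. Qed.

Lemma shape_sym X Y : g (A X) Y = g X (A Y).
Proof.
have := nabla_xi_skew_part X Y; rewrite !shapeE !metricE metric_phi_skew => E.
apply: subr0_eq; transitivity (g (B X) Y - g (B Y) X - (g X (phi Y) + g X (phi Y))).
  by rewrite (metric_sym g (B Y)); ring.
by rewrite E subrr.
Qed.

Lemma nabla_xiE X : B X = A X - phi X.
Proof. by rewrite !shapeE addrK. Qed.

Lemma shape_xi : A xi = 0.
Proof. by rewrite !shapeE nabla_xi_xi phi_xi addr0. Qed.

Lemma shapeD X Y : A (X + Y) = A X + A Y.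
Proof. by rewrite !shapeE nablaDl raddfD addrACA. Qed.
Lemma shapeZ f X : A (f *: X) = f *: A X.
Proof. by rewrite !shapeE nablaZl linearZ scalerDr. Qed.
Lemma shapeN X : A (- X) = - A X.
Proof. by rewrite -scaleN1r shapeZ scaleN1r. Qed.

Lemma eta_shape X : eta (A X) = 0.
Proof. by rewrite -metric_xi shape_sym shape_xi metric0r. Qed.

Lemma curvature_xiE X : curvature D xi X xi = D xi (B X) - B (D xi X) + B (B X).
Proof.
by rewrite /curvature nabla_xi_xi nabla0r subr0 (torsion_free LC) nablaDl nablaNl opprD
  opprK addrA.
Qed.

(** Differentiate along [xi] the equation [g (B X) Y - g (B Y) X = 2 g X (phi Y)],
    [B] being [D xi].  Since the derivative of [B] along [xi] is
    [R(xi, X) xi - B (B X)] and the curvature term is symmetric, only the skew part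
    of [B^2] remains, which is the anticommutator of [phi] and [shape]. *)
Lemma nabla_phi_shape X :
  D xi (phi X) - phi (D xi X) = - (phi (A X) + A (phi X)).
Proof.
apply: (metric_inj (g := g)) => Y; rewrite !(metric_sym g _ Y); move: Y X => X Y.
have NB Z W : g (B Z) W - g (B W) Z = g Z (phi W) + g Z (phi W).
  exact: nabla_xi_skew_part.
have R0 := curvature_pair LC xi X xi Y.
rewrite !curvature_xiE !metricE in R0.
have E := congr1 xi (NB X Y).
rewrite vf_actD vf_actN vf_actD !(metric_compat LC) in E.
have E1 := NB (D xi X) Y; have E2 := NB X (D xi Y).
have BB Z W : g (B (B Z)) W - g (B (B W)) Z =
   (g Z (phi (A W)) + g Z (A (phi W))) + (g Z (phi (A W)) + g Z (A (phi W))).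
  have F Z' W' : g (B (B Z')) W' =
     g (A Z') (A W') + g Z' (phi (A W')) + g Z' (A (phi W')) - g (phi Z') (phi W').
    rewrite [B (B Z')]nabla_xiE metricDl metricNl metric_phi_skew shape_sym nabla_xiE.
    by rewrite !metricE !metric_phi_skew -(shape_sym Z' (phi W')); ring.
  have a1 : g W (phi (A Z)) = - g Z (A (phi W)).
    by rewrite metric_sym metric_phi_skew shape_sym.
  have a2 : g W (A (phi Z)) = - g Z (phi (A W)).
    by rewrite metric_sym shape_sym metric_phi_skew.
  by rewrite !F (metric_sym g (A W)) (metric_sym g (phi W)) a1 a2; ring.
have E3 := BB X Y.
apply: cinf_double_inj; apply: subr0_eq.
(* Each zero is replaced by the difference of the sides of one equation. *)
transitivity (0 - 0 + 0 + 0 - 0 : cinf M); last by rewrite !subr0 !addr0.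
rewrite -{1}(eq_subr0 R0) -{1}(eq_subr0 E) -{1}(eq_subr0 E1) -{1}(eq_subr0 E2).
by rewrite -{1}(eq_subr0 E3) !metricE; ring.
Qed.

(** The derivative of [phi] along [xi] anticommutes with [phi], because [phi^2] is
    parallel along [xi].  It is also the anticommutator of [phi] and [shape] up to
    sign, which commutes with [phi] on the contact distribution: so it is zero. *)
Lemma shape_phi X : A (phi X) = - phi (A X).
Proof.
have NN : D xi (phi (phi X)) - phi (phi (D xi X)) = 0.
  rewrite !phi_phi !nablaE nabla_leibniz nabla_xi_xi scaler0 addr0.
  rewrite -metric_xi (metric_compat LC) nabla_xi_xi metric0r addr0 metric_xi.
  by rewrite subrr.
have := congr1 phi (nabla_phi_shape X); rewrite raddfB raddfN raddfD/= => N1.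
have N2 := nabla_phi_shape (phi X).
rewrite (phi_phi S (A X)) eta_shape scale0r addr0 in N1.
have App : A (phi (phi X)) = - A X.
  by rewrite phi_phi shapeD shapeN shapeZ shape_xi scaler0 addr0.
rewrite App in N2.
have : phi (A (phi X)) = A X.
  apply: (metric_inj (g := g)) => Y; apply: cinf_double_inj; apply: subr0_eq.
  transitivity (g (0 + 0 - 0) Y); last by rewrite subr0 addr0 metric0l.
  rewrite -{1}(eq_subr0 N1) -{1}(eq_subr0 N2) -{1}(eq_subr0 NN) !metricE.
  by ring.
move/(congr1 phi); rewrite phi_phi eta_shape scale0r addr0 => <-.
by rewrite opprK.
Qed.

Lemma nabla_xi_phi X : D xi (phi X) = phi (D xi X).
Proof.
by apply: subr0_eq; rewrite nabla_phi_shape shape_phi subrr oppr0.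
Qed.

Lemma h_shape X : h X = phi (A X).
Proof.
rewrite /h_endo /lie_endo !(torsion_free LC) nabla_xi_phi !nabla_xiE shape_phi.
rewrite !(phiD, phiN) opprD opprK; apply: (metric_inj (g := g)) => Y.
rewrite metricZl -[RHS]cinf_halfK; congr (_ * _).
by rewrite !metricE; ring.
Qed.

End ContactMetricGeometry.

(** * The (kappa, mu)-condition *)

Section KappaMu.
Local Open Scope ring_scope.
Context {R : realType} {n : nat} {M : manifold R n.*2.+1} (S : contact_metric n M).
Context (D : connection M).
Hypothesis LC : levi_civita (cm_metric S) D.
Implicit Types (X Y Z W : vfield M) (f : cinf M) (p : M).
Local Notation g := (cm_metric S).
Local Notation phi := (phi S).
Local Notation xi := (xi S).
Local Notation eta := (eta S).
Local Notation A := (shape S D).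
Local Notation B X := (D X xi).

Lemma phi_phi_shape X : phi (phi (A X)) = - A X.
Proof. by rewrite phi_phi (eta_shape LC) scale0r addr0. Qed.

Lemma jacobi_xi X :
  curvature D xi X xi = D xi (A X) - A (D xi X) + (A (A X) + phi (phi X)).
Proof.
rewrite (curvature_xiE LC) !nabla_xiE !(shapeD, shapeN, phiD, phiN, nablaDr, nablaNr).
rewrite (nabla_xi_phi LC) (shape_phi LC).
by apply: (metric_inj (g := g)) => Y; rewrite !metricE; ring.
Qed.

(** Conjugation by [phi] cancels the derivative of [shape] in [jacobi_xi], as
    [phi] is parallel along [xi] and anticommutes with [shape]. *)
Lemma shape_shape X : (A (A X) + phi (phi X)) + (A (A X) + phi (phi X)) =
  curvature D xi X xi - phi (curvature D xi (phi X) xi).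
Proof.
have phi2 : phi (phi (D xi (A X))) = - D xi (A X).
  by rewrite -!(nabla_xi_phi LC) phi_phi_shape nablaNr.
rewrite !jacobi_xi !(shape_phi LC) nablaNr !(nabla_xi_phi LC) !(shapeN, shape_phi LC).
rewrite !(phiD, phiN) phi2 !phi_phi_shape !phi_phi_phi.
by apply: (metric_inj (g := g)) => Y; rewrite !metricE; ring.
Qed.

Context (kappa mu : R).
Hypothesis KM : is_kappa_mu S D kappa mu.

Lemma kappa_mu_jacobi X : curvature D xi X xi =
  cinf_cst M kappa *: phi (phi X) - cinf_cst M mu *: phi (A X).
Proof.
rewrite KM !(h_shape LC) (shape_xi LC) eta_xi !scale1r phi_phi.
have -> : phi 0 = 0 by exact: raddf0.
by apply: (metric_inj (g := g)) => Y; rewrite !metricE; ring.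
Qed.

Lemma kappa_mu_shape_shape X : A (A X) = cinf_cst M (kappa - 1) *: phi (phi X).
Proof.
have := shape_shape X; rewrite !kappa_mu_jacobi !(phiD, phiN, phiZ) !(shape_phi LC).
rewrite !(phiN, phi_phi_phi) => E.
have -> : cinf_cst M (kappa - 1) = cinf_cst M kappa - 1 by exact: cinf_inj.
apply: (metric_inj (g := g)) => Y; apply: cinf_double_inj; apply: subr0_eq.
have := congr1 (g ^~ Y) E; rewrite !metricE => {}E.
by rewrite -{1}(eq_subr0 E); ring.
Qed.

(** [phi] takes values in the contact distribution, so that recurrence forces
    [R(xi, X) Z] to have no [xi] component at a point [p] where the recurrence form
    is not zero.  By skewness of the curvature this component is
    [- g Z (R(xi, X) xi)]. *)
Lemma phi_recurrent_kappa_mu0 : (0 < n)%N -> phi_recurrent S D -> kappa = 0 /\ mu = 0.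
Proof.
move=> n0 [al [W0 aW0] rec].
have [p ap] : exists p, al W0 p != 0.
  apply: contrapT => H; case/eqP: aW0; apply: cinf_inj => p; apply: contrapT => /eqP ?.
  by apply: H; exists p.
have K X Z : kappa * g (phi X) (phi Z) p + mu * g (phi (A X)) Z p = 0.
  have := congr1 eta (rec xi X Z W0).
  rewrite eta_phi etaZ -metric_xi (curvature_skew LC) kappa_mu_jacobi !metricE.
  rewrite -[g Z (phi (phi X))]opprK -metric_phi_skew.
  rewrite (metric_sym g (phi Z)) (metric_sym g Z).
  move/(congr1 (fun f : cinf M => f p)); rewrite !cinfE => /eqP.
  rewrite eq_sym mulf_eq0 (negPf ap) /= => /eqP E.
  by rewrite -[RHS]E; ring.
have [X X0] := contact_nonnull S p n0.
(* Replacing [X] by [phi X] changes the sign of the [mu] term only. *)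
have k0 : kappa = 0.
  have KX := K X X; have := K (phi X) (phi X).
  rewrite metric_phi eta_phi mulr0 subr0 (shape_phi LC) phiN phi_phi_shape opprK.
  have -> : g (A X) (phi X) = - g (phi (A X)) X by rewrite metric_phi_skew opprK.
  rewrite cinfNE => KfX.
  have /eqP : kappa * g (phi X) (phi X) p = 0 by lra.
  by rewrite mulf_eq0 (negPf X0) orbF => /eqP.
split=> //; have := K X (phi (A X)); rewrite k0 mul0r add0r metric_phi (eta_shape LC) mul0r subr0.
rewrite (shape_sym LC) kappa_mu_shape_shape k0 sub0r metricZr.
rewrite -[g X (phi _)]opprK -metric_phi_skew cinfME cinfNE [cinf_cst M _ p]/= mulN1r opprK.
by move=> /eqP; rewrite mulf_eq0 (negPf X0) orbF => /eqP.
Qed.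

End KappaMu.

(** * Contact metric structures with [R(X, Y) xi = 0] *)

Section XiFlat.
Local Open Scope ring_scope.
Context {R : realType} {n : nat} {M : manifold R n.*2.+1} (S : contact_metric n M).
Context (D : connection M).
Hypothesis LC : levi_civita (cm_metric S) D.
Hypothesis Rxi : forall X Y, curvature D X Y (xi S) = 0.
Implicit Types (X Y Z W U V : vfield M) (f : cinf M) (p : M).
Local Notation g := (cm_metric S).
Local Notation phi := (phi S).
Local Notation xi := (xi S).
Local Notation eta := (eta S).
Local Notation A := (shape S D).
Local Notation B X := (D X xi).
Local Notation half := (cinf_cst M 2^-1).

Lemma shape_shape_xi_flat X : A (A X) = - phi (phi X).
Proof.
have := shape_shape LC X; rewrite !Rxi => E.
apply: (metric_inj (g := g)) => Y; apply: cinf_double_inj; apply: subr0_eq.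
have := congr1 (g ^~ Y) E; rewrite (_ : phi 0 = 0) ?subr0; last exact: raddf0.
by rewrite !metricE => {}E; rewrite -[RHS]E; ring.
Qed.

(** On the contact distribution [shape] is [- phi h], and these are the fields with
    [h X = X] and with [h X = - X]; the two parts below are [(h - phi^2) X] and
    [- (h + phi^2) X], twice the projections onto the eigenbundles. *)
Definition plus_field X := A X = - phi X /\ eta X = 0.
Definition minus_field X := A X = phi X /\ eta X = 0.
Definition plus_part X := phi (A X) - phi (phi X).
Definition minus_part X := - phi (A X) - phi (phi X).

Lemma plus_partP X : plus_field (plus_part X).
Proof.
split; last by rewrite etaD etaN !eta_phi subr0.
rewrite /plus_part shapeD shapeN !(shape_phi LC) shape_shape_xi_flat.
rewrite !(phiD, phiN) !phi_phi_phi (phi_phi_shape LC).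
by apply: (metric_inj (g := g)) => Y; rewrite !metricE; ring.
Qed.

Lemma minus_partP X : minus_field (minus_part X).
Proof.
split; last by rewrite etaD !etaN !eta_phi subr0 oppr0.
rewrite /minus_part shapeD !shapeN !(shape_phi LC) shape_shape_xi_flat.
rewrite !(phiD, phiN) !phi_phi_phi (phi_phi_shape LC).
by apply: (metric_inj (g := g)) => Y; rewrite !metricE; ring.
Qed.

Lemma xi_split V : V = half *: plus_part V + half *: minus_part V + eta V *: xi.
Proof.
rewrite -scalerDr /plus_part /minus_part phi_phi.
apply: (metric_inj (g := g)) => Y; rewrite !metricE.
rewrite -[LHS]mul1r -[X in _ = _ + X]mul1r -cinf_half.
by ring.
Qed.

(** It suffices to check a tensorial expression on eigenfields and on [xi]. *)
Lemma xi_split_ind (L : vfield M -> cinf M) :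
  (forall X Y, L (X + Y) = L X + L Y) -> (forall f X, L (f *: X) = f * L X) ->
  L xi = 0 -> (forall X, plus_field X -> L X = 0) ->
  (forall X, minus_field X -> L X = 0) -> forall V, L V = 0.
Proof.
move=> LD LZ Lxi LP LM V; rewrite [V]xi_split !LD !LZ Lxi.
by rewrite (LP _ (plus_partP V)) (LM _ (minus_partP V)) !mulr0 !addr0.
Qed.

Lemma phi_plus X : plus_field X -> minus_field (phi X).
Proof. by case=> AX eX; rewrite /minus_field (shape_phi LC) AX phiN opprK eta_phi. Qed.

Lemma phi_minus X : minus_field X -> plus_field (phi X).
Proof. by case=> AX eX; rewrite /plus_field (shape_phi LC) AX eta_phi. Qed.

Lemma minus_phi Z : minus_field Z -> exists2 X, plus_field X & Z = phi X.
Proof.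
move=> ZM; exists (- phi Z).
  have [AZ eZ] := phi_minus ZM.
  by rewrite /plus_field shapeN AZ phiN etaN eZ oppr0.
by rewrite phiN phi_phi ZM.2 scale0r addr0 opprK.
Qed.

Lemma plus_minus_orth X Z : plus_field X -> minus_field Z -> g X Z = 0.
Proof.
move=> [AX eX] [AZ eZ]; apply: cinf_double_eq0.
have := shape_sym LC X (phi Z); rewrite (shape_phi LC) AX AZ phi_phi eZ scale0r addr0.
rewrite opprK metricNl metric_phi eX mul0r subr0 => E.
by rewrite -{1}E addNr.
Qed.

Lemma nabla_xi_plus X : plus_field X -> B X = - (phi X + phi X).
Proof. by case=> AX _; rewrite nabla_xiE AX opprD. Qed.

Lemma nabla_xi_minus Z : minus_field Z -> B Z = 0.
Proof. by case=> AZ _; rewrite nabla_xiE AZ subrr. Qed.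

(** [D xi = - phi (1 + h)], where [1 + h] maps to the (+1)-bundle up to multiples of
    [xi], and [phi] kills [xi] and exchanges the two bundles. *)
Lemma minus_nabla_xi V : minus_field (B V).
Proof.
split; last exact: eta_nabla_xi.
rewrite !nabla_xiE shapeD shapeN (shape_phi LC) shape_shape_xi_flat phiD phiN.
by rewrite opprK addrC.
Qed.

(** Used to read off membership of [D Y (phi X)] from
    [D Y (B X) = - 2 D Y (phi X)]. *)
Lemma minus_field_halve X : minus_field (- (X + X)) -> minus_field X.
Proof.
have XE : X = - half *: - (X + X).
  by apply: (metric_inj (g := g)) => Y; rewrite metricZl metricNl metricDl mulrNN cinf_halfK.
by case=> AX eX; rewrite XE; split; [rewrite shapeZ phiZ AX|rewrite etaZ eX mulr0].
Qed.

(** For [X] in the (+1)-bundle, [R(Y, X) xi = 0] reads [D Y (B X) = B [Y, X]], and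
    [B] takes values in the (-1)-bundle. *)
Lemma nabla_minus_minus Y Z : minus_field Y -> minus_field Z -> minus_field (D Y Z).
Proof.
move=> YM /minus_phi[X XP ->]; apply: minus_field_halve.
have := Rxi Y X; rewrite /curvature (nabla_xi_minus YM) nabla0r subr0 (nabla_xi_plus XP).
rewrite nablaNr nablaDr => /eqP; rewrite subr_eq0 => /eqP ->.
exact: minus_nabla_xi.
Qed.

Lemma nabla_xi_field_minus Z : minus_field Z -> minus_field (D xi Z).
Proof.
case/minus_phi=> X XP ->; apply: minus_field_halve.
have := Rxi xi X; rewrite /curvature (nabla_xi_xi LC) nabla0r subr0 (nabla_xi_plus XP).
rewrite nablaNr nablaDr => /eqP; rewrite subr_eq0 => /eqP ->.
exact: minus_nabla_xi.
Qed.

(** The (+1) component of [R(X, Y) xi = 0]. *)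
Lemma second_form_sym X Y W : plus_field X -> plus_field Y -> plus_field W ->
  g (D X (phi Y)) W = g (D Y (phi X)) W.
Proof.
move=> XP YP WP; apply: cinf_double_inj; apply: subr0_eq.
have := Rxi X Y; rewrite /curvature (nabla_xi_plus XP) (nabla_xi_plus YP).
rewrite !nablaNr !nablaDr => /(congr1 (g ^~ W)).
rewrite !metricE [g (B _) W]metric_sym (plus_minus_orth WP (minus_nabla_xi _)) => E.
by rewrite -[RHS]oppr0 -[in RHS]E; ring.
Qed.

(** The [phi W] component of [R(Y, X) xi = 0]. *)
Lemma nabla_minus_phi Y X W : minus_field Y -> plus_field X -> plus_field W ->
  g (D Y (phi X)) (phi W) = g (D Y X) W - g (D X Y) W.
Proof.
move=> YM XP WP; apply: cinf_double_inj; apply: subr0_eq.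
have := Rxi Y X; rewrite /curvature (nabla_xi_minus YM) nabla0r subr0 (nabla_xi_plus XP).
rewrite nablaNr nablaDr nabla_xiE => /(congr1 (g ^~ (phi W))).
rewrite !metricE [g (A _) _](shape_sym LC) (shape_phi LC) (proj1 WP) phiN opprK.
rewrite metric_phi (proj2 WP) mulr0 subr0 phi_phi (proj2 WP) scale0r addr0.
rewrite (torsion_free LC) !metricE => E.
by rewrite -[RHS]oppr0 -[in RHS]E; ring.
Qed.

(** Symmetrize [nabla_minus_phi] in [X] and [W], with [phi Y] in place of [Y]: as
    [phi] is isometric on the contact distribution, the metric compatibility terms
    cancel. *)
Lemma second_form_skew X Y W : plus_field X -> plus_field Y -> plus_field W ->
  g (D X (phi Y)) W = - g (D W (phi Y)) X.
Proof.
move=> XP YP WP; have YM := phi_plus YP.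
have := metric_phi S X W; rewrite (proj2 XP) mul0r subr0.
move/(congr1 (fun f : cinf M => (phi Y : vfield M) f)).
rewrite !(metric_compat LC) (metric_sym g (phi X)) (metric_sym g X).
rewrite (nabla_minus_phi YM XP WP) (nabla_minus_phi YM WP XP) => E.
by apply: subr0_eq; rewrite -[RHS]oppr0 -[in RHS](eq_subr0 E); ring.
Qed.

(** A trilinear form that is symmetric in its first two arguments and skew in the
    first and third vanishes: alternating the two exchanges three times returns to
    the start with a minus sign. *)
Lemma second_form_eq0 X Y W : plus_field X -> plus_field Y -> plus_field W ->
  g (D X (phi Y)) W = 0.
Proof.
move=> XP YP WP; apply: cinf_double_eq0; apply/eqP; rewrite addr_eq0; apply/eqP.
rewrite {1}(second_form_sym XP YP WP) (second_form_skew YP XP WP).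
rewrite (second_form_sym WP XP YP) (second_form_skew XP WP YP).
by rewrite (second_form_sym YP WP XP) (second_form_skew WP YP XP) !opprK.
Qed.

Lemma nabla_minus_plus V Z W : minus_field Z -> plus_field W -> g (D V Z) W = 0.
Proof.
move=> ZM WP.
apply: (@xi_split_ind (fun U => g (D U Z) W)) => [U1 U2|f U||X XP|Y YM].
- by rewrite nablaDl metricDl.
- by rewrite nablaZl metricZl.
- by rewrite metric_sym (plus_minus_orth WP (nabla_xi_field_minus ZM)).
- by have [Y YP ->] := minus_phi ZM; exact: second_form_eq0.
- by rewrite metric_sym (plus_minus_orth WP (nabla_minus_minus YM ZM)).
Qed.

(** By [nabla_minus_plus] the derivative of [Z] is a (-1)-field plus a multiple of
    [xi]; deriving it along [Y] again yields no (+1) component, as [D Y xi = 0]. *)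
Lemma curvature_mixed V Y Z W : minus_field Y -> minus_field Z -> plus_field W ->
  g (curvature D V Y Z) W = 0.
Proof.
move=> YM ZM WP.
have P0 : plus_part (D V Z) = 0.
  apply: (metric_eq0 (g := g)) => U; rewrite -[RHS](nabla_minus_plus V ZM (plus_partP U)).
  rewrite /plus_part !metricE !metric_phi_skew (shape_sym LC) (shape_phi LC) metricNr.
  by rewrite !opprK.
have DVZ := xi_split (D V Z); rewrite P0 scaler0 add0r in DVZ.
have D0 : g (D Y (D V Z)) W = 0.
  rewrite {}DVZ nablaDr !nabla_leibniz vf_act_cst scale0r add0r (nabla_xi_minus YM).
  rewrite scaler0 addr0 metricDl !metricZl (nabla_minus_plus _ (minus_partP _) WP).
  by rewrite metric_sym metric_xi (proj2 WP) !mulr0 addr0.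
rewrite /curvature !metricDl !metricNl D0 (nabla_minus_plus _ ZM WP).
by rewrite (nabla_minus_plus _ (nabla_minus_minus YM ZM) WP) !subr0.
Qed.

End XiFlat.

(** * Dimension three *)

Section ThreeDimensional.
Local Open Scope ring_scope.
Context {R : realType} {M : manifold R 3} (S : contact_metric 1 M).
Context (D : connection M).
Hypothesis LC : levi_civita (cm_metric S) D.
Implicit Types (X Y Z W U V : vfield M) (f : cinf M) (p : M).
Local Notation g := (cm_metric S).
Local Notation phi := (phi S).
Local Notation xi := (xi S).
Local Notation eta := (eta S).

(** [X] and [Y] are both orthogonal to [phi X] and [xi], which leaves only one
    direction where [X] is not zero: in a relation among [X], [Y], [phi X], [xi]
    the last two coefficients vanish. *)
Lemma contact_collinear X Y W : eta X = 0 -> eta Y = 0 -> g Y (phi X) = 0 ->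
  g X X * g Y W = g X Y * g X W.
Proof.
move=> eX eY YfX; apply: cinf_inj => p; rewrite !cinfE.
have [q0|q0] := eqVneq (g X X p) 0.
  by rewrite q0 (metric_null Y q0) !mul0r.
pose E (i : 'I_4) := nth 0 [:: X; Y; phi X; xi] i.
have [c [i ci] cE] := metric_dependent g E p.
have XfX : g X (phi X) = 0.
  by apply: cinf_double_eq0; rewrite -{1}[g X _]opprK -metric_phi_skew metric_sym addNr.
pose i1 : 'I_4 := lift ord0 ord0; pose i2 : 'I_4 := lift ord0 (lift ord0 ord0).
pose i3 : 'I_4 := lift ord0 (lift ord0 (lift ord0 ord0)).
have sumE Z : c ord0 * g X Z p + c i1 * g Y Z p + c i2 * g (phi X) Z p
    + c i3 * g xi Z p = 0.
  by rewrite -[RHS](cE Z) !big_ord_recl big_ord0 addr0 !addrA.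
have c3 : c i3 = 0.
  have := sumE xi; rewrite !metric_xi eX eY eta_phi eta_xi !cinfE !mulr0 !add0r.
  by rewrite mulr1.
have c2 : c i2 = 0.
  have := sumE (phi X); rewrite c3 XfX YfX metric_phi eX mul0r subr0 !cinfE !mulr0 !add0r.
  by rewrite mul0r addr0 => /eqP; rewrite mulf_eq0 (negPf q0) orbF => /eqP.
have sumE' Z : c ord0 * g X Z p + c i1 * g Y Z p = 0.
  by have := sumE Z; rewrite c2 c3 !mul0r !addr0.
have c1 : c i1 != 0.
  apply: contraNneq ci => c1.
  have c0 : c ord0 = 0.
    have := sumE' X; rewrite c1 mul0r addr0 => /eqP.
    by rewrite mulf_eq0 (negPf q0) orbF => /eqP.
  case: i => [[|[|[|[|//]]]] lti].
  - by rewrite (_ : Ordinal lti = ord0) ?c0//; exact: val_inj.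
  - by rewrite (_ : Ordinal lti = i1) ?c1//; exact: val_inj.
  - by rewrite (_ : Ordinal lti = i2) ?c2//; exact: val_inj.
  - by rewrite (_ : Ordinal lti = i3) ?c3//; exact: val_inj.
apply: (mulfI c1); have EX := sumE' X; have EW := sumE' W.
rewrite (metric_sym g X Y); apply: subr0_eq.
transitivity (g X X p * 0 - g X W p * 0); last by rewrite !mulr0 subr0.
by rewrite -{1}EW -EX; ring.
Qed.

(** [R(Z, W)] is skew, so that its value on two collinear fields is zero. *)
Lemma curvature_collinear X Y Z W :
  eta X = 0 -> eta Y = 0 -> g Y (phi X) = 0 -> g (curvature D X Y Z) W = 0.
Proof.
move=> eX eY YfX; rewrite (curvature_pair LC).
have skew := curvature_skew LC Z W.
have RXX : g (curvature D Z W X) X = 0.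
  by apply: cinf_double_eq0; rewrite {1}skew metric_sym addNr.
have := contact_collinear (curvature D Z W X) eX eY YfX.
rewrite [g X (curvature _ _ _ _)]metric_sym RXX mulr0 => qE.
apply: cinf_inj => p; have [q0|q0] := eqVneq (g X X p) 0.
  by rewrite skew cinfNE (metric_null _ q0) oppr0.
have /eqP := congr1 (fun f : cinf M => f p) qE.
by rewrite cinfME mulf_eq0 (negPf q0) metric_sym => /eqP.
Qed.

Hypothesis Rxi : forall X Y, curvature D X Y xi = 0.

(** Split all four arguments of [g (R(X, Y) Z) W] into eigenfields and multiples of
    [xi].  Components containing [xi] vanish by hypothesis, those with [X], [Y] or
    [Z], [W] in the same eigenbundle by [curvature_collinear], and the others by
    [curvature_mixed]. *)
Lemma xi_flat_flat : flat D.
Proof.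
have C X Y Z W : g (curvature D X Y Z) W = - g (curvature D Y X Z) W.
  by rewrite curvatureC metricNl.
have K X Y Z W : g (curvature D X Y Z) W = - g (curvature D X Y W) Z.
  by rewrite (curvature_skew LC) metric_sym.
have PP X Y Z W : plus_field S D X -> plus_field S D Y ->
    g (curvature D X Y Z) W = 0.
  move=> XP YP; apply: curvature_collinear; [exact: XP.2|exact: YP.2|].
  exact: (plus_minus_orth LC) YP (phi_plus LC XP).
have MM X Y Z W : minus_field S D X -> minus_field S D Y ->
    g (curvature D X Y Z) W = 0.
  move=> XM YM; apply: curvature_collinear; [exact: XM.2|exact: YM.2|].
  by rewrite metric_sym; exact: (plus_minus_orth LC) (phi_minus LC XM) YM.
have xi4 X Y Z : g (curvature D X Y Z) xi = 0 by rewrite K Rxi metric0l oppr0.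
have ind4 X Y Z : (forall W, plus_field S D W -> g (curvature D X Y Z) W = 0) ->
    (forall W, minus_field S D W -> g (curvature D X Y Z) W = 0) ->
    forall W, g (curvature D X Y Z) W = 0.
  move=> HP HM; apply: (xi_split_ind LC Rxi (L := g (curvature D X Y Z))) => //.
    by move=> *; rewrite metricDr.
  by move=> *; rewrite metricZr.
have PM X Y Z W : plus_field S D X -> minus_field S D Y ->
    g (curvature D X Y Z) W = 0.
  move=> XP YM; have RM U V : minus_field S D U -> g (curvature D X Y U) V = 0.
    move=> UM; apply: ind4 => {}V HV; first exact: (curvature_mixed LC Rxi).
    by rewrite (curvature_pair LC) MM.
  have RP U V : plus_field S D U -> g (curvature D X Y U) V = 0.
    move=> UP; apply: ind4 => {}V HV; first by rewrite (curvature_pair LC) PP.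
    by rewrite K RM ?oppr0.
  rewrite K; apply/eqP; rewrite oppr_eq0; apply/eqP.
  by apply: ind4 => {}Z HZ; rewrite K ?(RP _ _ HZ) ?(RM _ _ HZ) oppr0.
have ind1 Y Z W : (forall X, plus_field S D X -> g (curvature D X Y Z) W = 0) ->
    (forall X, minus_field S D X -> g (curvature D X Y Z) W = 0) ->
    forall X, g (curvature D X Y Z) W = 0.
  move=> HP HM; apply: (xi_split_ind LC Rxi (L := fun X => g (curvature D X Y Z) W)) => //.
  - by move=> *; rewrite (curvatureD g) metricDl.
  - by move=> *; rewrite (curvatureZ g) metricZl.
  - by rewrite (curvature_pair LC) Rxi metric0l.
move=> X Y Z; apply: (metric_eq0 (g := g)) => W.
move: X; apply: (ind1 _ _ _) => X HX; rewrite C; apply/eqP; rewrite oppr_eq0; apply/eqP;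
  move: Y; apply: (ind1 _ _ _) => Y HY.
- exact: PP.
- by rewrite C PM ?oppr0.
- exact: PM.
- exact: MM.
Qed.

End ThreeDimensional.

Theorem theorem4p3 (R : realType) (M : manifold R 3) (S : contact_metric 1 M)
    (D : connection M) (kappa mu : R) :
  levi_civita (cm_metric S) D -> is_kappa_mu S D kappa mu ->
  (phi_recurrent S D <-> flat D).
Proof.
move=> LC KM; split=> [rec|flatD].
  have [k0 m0] := phi_recurrent_kappa_mu0 LC KM isT rec.
  apply: (xi_flat_flat LC) => X Y; rewrite KM k0 m0.
  have c0 : cinf_cst M 0 = 0%R by exact: cinf_inj.
  by rewrite !c0 !scale0r addr0.
exists (eta S) => [|X Y Z W].
  by exists (xi S); rewrite eta_xi oner_eq0.
rewrite /nabla_curvature !flatD nabla0r !subr0 scaler0.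
by rewrite !raddf0.
Qed.
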